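(* Let $(M,\varphi,\xi,\eta,g)$ be a $3$-dimensional trans-Sasakian manifold of type $(\alpha,\beta)$ equipped with a Newman--Penrose frame $(\partial,\overline{\partial},\xi)$, and let $a$ be a real constant. Then $M$ is an Einstein manifold with $S=ag$ (where $S$ is the Ricci tensor) if and only if $$a=-|\rho_{\mathrm{np}}|^2-2|\beta_{\mathrm{np}}|^2-(\rho_{\mathrm{np}}-\overline{\rho_{\mathrm{np}}})\epsilon_{\mathrm{np}}-\xi(\rho_{\mathrm{np}})-\rho_{\mathrm{np}}^2-\partial(\overline{\beta_{\mathrm{np}}})-\overline{\partial}(\beta_{\mathrm{np}})=-2\xi(\rho_{\mathrm{np}})-2\rho_{\mathrm{np}}^2$$ and $$\partial(\rho_{\mathrm{np}})=0.$$
   Context: An almost contact metric structure $(\varphi,\xi,\eta,g)$ on $M$: $\varphi$ a $(1,1)$-tensor, $\xi$ a vector field, $\eta$ a $1$-form, $g$ a Riemannian metric with $\varphi^2=-I+\eta\otimes\xi$, $\eta(\xi)=1$, $\varphi\xi=0$, $\eta\circ\varphi=0$, $g(\varphi X,\varphi Y)=g(X,Y)-\eta(X)\eta(Y)$. It is trans-Sasakian of type $(\alpha,\beta)$ ($\alpha,\beta$ smooth functions) if $(\nabla_X\varphi)Y=\alpha(g(X,Y)\xi-\eta(Y)X)+\beta(g(\varphi X,Y)\xi-\eta(Y)\varphi X)$, with $\nabla$ the Levi-Civita connection. Newman--Penrose frame: for an orthonormal frame $(e_1,e_2,\xi)$, put $\partial=\frac1{\sqrt2}(e_1-ie_2)$,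 $\overline{\partial}=\frac1{\sqrt2}(e_1+ie_2)$, chosen so that $\varphi\partial=i\partial$, $\varphi\overline{\partial}=-i\overline{\partial}$ (i.e. $\varphi e_1=e_2$). All tensors and $\nabla$ are extended complex-(multi)linearly, so $g(\xi,\xi)=g(\partial,\overline{\partial})=1$ and $g(\xi,\partial)=g(\partial,\partial)=g(\overline{\partial},\overline{\partial})=0$. Spin coefficients: $\sigma_{\mathrm{np}}=-g(\partial,\nabla_\partial\xi)$, $\rho_{\mathrm{np}}=g(\partial,\nabla_{\overline{\partial}}\xi)$, $\kappa_{\mathrm{np}}=-g(\partial,\nabla_\xi\xi)$, $\beta_{\mathrm{np}}=g(\overline{\partial},\nabla_\partial\partial)$, $\epsilon_{\mathrm{np}}=g(\overline{\partial},\nabla_\xi\partial)$. In these terms the trans-Sasakian condition of type $(\alpha,\beta)$ reads $\kappa_{\mathrm{np}}=\sigma_{\mathrm{np}}=0$, $\rho_{\mathrm{np}}=\beta+i\alpha$. For a function $f$, $\partial(f),\overline{\partial}(f),\xi(f)$ denote derivatives along these vector fields. $S(Y,Z)=\operatorname{tr}(X\mapsto R(X,Y)Z)$ with $R(X,Y)=[\nabla_X,\nabla_Y]-\nabla_{[X,Y]}$. *)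

(* Defs.v *)
From HB Require Import structures.
From mathcomp Require Import all_boot all_order all_algebra.
From mathcomp Require Import all_classical all_reals all_analysis.
From mathcomp Require Import complex.

Set Implicit Arguments.
Unset Strict Implicit.
Unset Printing Implicit Defensive.

Import Order.TTheory GRing.Theory Num.Theory.
Import numFieldNormedType.Exports.

#[local] Obligation Tactic := idtac.

Local Open Scope classical_set_scope.
Local Open Scope ring_scope.

(* All iterated partial derivatives of [f] of order at most [k] exist and are
   (Frechet) differentiable at every point of [U]. *)
Fixpoint diff_upto (R : realType) (n k : nat) (U : set 'rV[R]_n)
    (f : 'rV[R]_n -> R) : Prop :=
  (forall x, U x -> differentiable f x) /\
  if k is k'.+1
  then forall i : 'I_n, diff_upto k' U (fun x => 'D_(delta_mx 0 i) f x)
  else True.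

Definition smooth_on (R : realType) (n : nat) (U : set 'rV[R]_n)
    (f : 'rV[R]_n -> R) : Prop := forall k, diff_upto k U f.

Lemma near_eq_differentiable (R : realType) (V W : normedModType R)
    (f h : V -> W) (x : V) :
  (\near x, f x = h x) -> differentiable f x -> differentiable h x.
Proof.
move=> fh df; have fhx : f x = h x := nbhs_singleton fh.
have hE : h \o shift x = cst (h x) + 'd f x +o_ (0 : V) id.
  have /diff_locally/eqaddoP fE := df.
  apply/eqaddoP => e /fE; rewrite (near_shift 0 x) subr0 in fh.
  by apply: filterS2 fh => y /= fhy; rewrite !fctE /= fhy fhx.
have dh : 'd h x = 'd f x :> (V -> W).
  by apply: diff_unique => //; exact: diff_continuous.
by apply/diff_locallyP; rewrite dh; split=> //; exact: diff_continuous.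
Qed.

Section SmoothOnTheory.
Variables (R : realType) (n : nat) (U : set 'rV[R]_n).
Hypothesis oU : open U.
Implicit Types f h : 'rV[R]_n -> R.

Lemma diff_upto_eq k f h : (forall x, U x -> f x = h x) ->
  diff_upto k U f -> diff_upto k U h.
Proof.
elim: k f h => [|k IHk] f h fh [df Df]; split=> //.
- move=> x Ux; apply: near_eq_differentiable (df x Ux).
  by apply: filterS (open_nbhs_nbhs (conj oU Ux)) => y /fh.
- move=> x Ux; apply: near_eq_differentiable (df x Ux).
  by apply: filterS (open_nbhs_nbhs (conj oU Ux)) => y /fh.
- move=> i; apply: IHk (Df i) => x Ux; apply: near_eq_derive.
  by apply: filterS (open_nbhs_nbhs (conj oU Ux)) => y /fh.
Qed.

Lemma diff_uptoW k f : diff_upto k.+1 U f -> diff_upto k U f.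
Proof.
elim: k f => [|k IHk] f [df Df]; split=> // i.
exact: IHk (Df i).
Qed.

Lemma diff_upto_cst k (c : R) : diff_upto k U (cst c).
Proof.
elim: k c => [|k IHk] c; split=> //; try by move=> x _; exact: differentiable_cst.
move=> i; apply: (@diff_upto_eq _ (cst 0)) (IHk 0) => x Ux.
by rewrite /= derive_cst.
Qed.

Lemma diff_uptoD k f h :
  diff_upto k U f -> diff_upto k U h -> diff_upto k U (f + h).
Proof.
elim: k f h => [|k IHk] f h [df Df] [dh Dh]; split=> //.
- by move=> x Ux; apply: differentiableD; [exact: df | exact: dh].
- by move=> x Ux; apply: differentiableD; [exact: df | exact: dh].
move=> i; apply: diff_upto_eq (IHk _ _ (Df i) (Dh i)) => x Ux.
by rewrite deriveD //; apply: diff_derivable; [exact: df | exact: dh].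
Qed.

Lemma diff_uptoM k f h :
  diff_upto k U f -> diff_upto k U h -> diff_upto k U (f * h).
Proof.
elim: k f h => [|k IHk] f h sf sh; have [df Df] := sf; have [dh Dh] := sh;
  split=> //.
- by move=> x Ux; apply: differentiableM; [exact: df | exact: dh].
- by move=> x Ux; apply: differentiableM; [exact: df | exact: dh].
move=> i; have /= fDh := IHk _ _ (diff_uptoW sf) (Dh i).
have /= hDf := IHk _ _ (diff_uptoW sh) (Df i).
apply: diff_upto_eq (diff_uptoD fDh hDf) => x Ux.
by rewrite deriveM //; apply: diff_derivable; [exact: df | exact: dh].
Qed.

End SmoothOnTheory.

Record chart (R : realType) (n : nat) (M : topologicalType) := Chart {
  chart_dom : set M;
  chart_map : M -> 'rV[R]_n;
  chart_inv : 'rV[R]_n -> M;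
  chart_open : open chart_dom;
  chart_open_im : open (chart_map @` chart_dom);
  chartK : forall p, chart_dom p -> chart_inv (chart_map p) = p;
  chart_cont : forall p, chart_dom p -> {for p, continuous chart_map};
  chart_inv_cont : forall x, (chart_map @` chart_dom) x ->
    {for x, continuous chart_inv} }.

Record manifold (R : realType) (n : nat) := Manifold {
  carrier :> topologicalType;
  manifold_hausdorff : hausdorff_space carrier;
  manifold_second_countable : @second_countable carrier;
  atlas : set (chart R n carrier);
  atlas_cover : forall p, exists2 c, atlas c & chart_dom c p;
  atlas_compat : forall c c', atlas c -> atlas c' -> forall i : 'I_n,
    smooth_on (chart_map c @` (chart_dom c `&` chart_dom c'))
      (fun x => chart_map c' (chart_inv c x) 0 i) }.

Definition smooth (R : realType) (n : nat) (M : manifold R n) (f : M -> R) :=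
  forall c, @atlas R n M c ->
    smooth_on (chart_map c @` chart_dom c) (f \o chart_inv c).

Section SmoothFunctions.
Variables (R : realType) (n : nat) (M : manifold R n).
Implicit Types f h : M -> R.

Definition smooth_pred : {pred M -> R} := fun f => `[< smooth f >].

Lemma smooth_cst (c : R) : smooth (cst c : M -> R).
Proof. by move=> u _ k; apply: diff_upto_cst; exact: chart_open_im. Qed.

Lemma smoothD f h : smooth f -> smooth h -> smooth (f + h).
Proof.
move=> sf sh u Au k.
by apply: diff_uptoD; [exact: chart_open_im | exact: sf | exact: sh].
Qed.

Lemma smoothM f h : smooth f -> smooth h -> smooth (f * h).
Proof.
move=> sf sh u Au k.
by apply: diff_uptoM; [exact: chart_open_im | exact: sf | exact: sh].
Qed.

Lemma smoothZ (c : R) f : smooth f -> smooth (c *: f).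
Proof. by move=> sf; exact: smoothM (smooth_cst c) sf. Qed.

Fact smooth_subring_closed : subring_closed smooth_pred.
Proof.
split.
- by apply/asboolP; exact: smooth_cst.
- move=> f h /asboolP sf /asboolP sh; apply/asboolP; apply: smoothD => //.
  by rewrite -scaleN1r; exact: smoothZ.
- by move=> f h /asboolP sf /asboolP sh; apply/asboolP; exact: smoothM.
Qed.

Fact smooth_scaler_closed : GRing.scaler_closed smooth_pred.
Proof. by move=> c f /asboolP sf; apply/asboolP; exact: smoothZ. Qed.

HB.instance Definition _ :=
  GRing.isSubringClosed.Build (M -> R) smooth_pred smooth_subring_closed.
HB.instance Definition _ :=
  GRing.isScaleClosed.Build R (M -> R) smooth_pred smooth_scaler_closed.

Record smooth_fun := SmoothFun {
  sfun_val :> M -> R;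
  sfun_smooth : sfun_val \in smooth_pred }.

HB.instance Definition _ := [isSub for sfun_val].
HB.instance Definition _ := [Choice of smooth_fun by <:].
HB.instance Definition _ := GRing.SubChoice_isSubComPzRing.Build
  (M -> R) smooth_pred smooth_fun (GRing.subringClosedP smooth_pred).
HB.instance Definition _ := [SubZmodule_isSubLmodule of smooth_fun by <:].

Definition smooth_const (c : R) : smooth_fun := c *: (1 : smooth_fun).

End SmoothFunctions.

Section VectorFields.
Variables (R : realType) (n : nat) (M : manifold R n).
Local Notation C := (smooth_fun M).
Implicit Types f h : C.

(* Vector fields are derivations of the algebra of smooth functions. *)
Record vector_field := VectorField {
  vf_fun :> C -> C;
  vf_linear : linear vf_fun;
  vf_leibniz : forall f h, vf_fun (f * h) = vf_fun f * h + f * vf_fun h }.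

Implicit Types X Y Z : vector_field.

Lemma vf_ext X Y : (forall f, X f = Y f) -> X = Y.
Proof.
case: X Y => [X lX dX] [Y lY dY] /= /funext XY; subst Y.
by congr VectorField; exact: Prop_irrelevance.
Qed.

HB.instance Definition _ := gen_eqMixin vector_field.
HB.instance Definition _ := gen_choiceMixin vector_field.

Lemma vfD X f h : X (f + h) = X f + X h.
Proof. by have := vf_linear X 1 f h; rewrite !scale1r. Qed.

Lemma vf0 X : X 0 = 0.
Proof. by apply: (addrI (X 0)); rewrite -vfD !addr0. Qed.

Lemma vfZ X (c : R) f : X (c *: f) = c *: X f.
Proof. by have := vf_linear X c f 0; rewrite vf0 !addr0. Qed.

Lemma vfB X f h : X (f - h) = X f - X h.
Proof. by rewrite -scaleN1r vfD vfZ scaleN1r. Qed.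

(* C is not declared as an R-algebra, hence this compatibility of the R-module
   structure of C with its product. *)
Lemma sfun_scalerAr (c : R) f h : c *: (f * h) = f * (c *: h).
Proof. by apply/val_inj/funext => p /=; rewrite !fctE /= mulrCA. Qed.

Program Definition vf_zero := @VectorField (fun=> 0) _ _.
Next Obligation. by move=> c f h /=; rewrite scaler0 addr0. Qed.
Next Obligation. by move=> f h /=; rewrite mul0r mulr0 addr0. Qed.

Program Definition vf_add X Y := @VectorField (fun f => X f + Y f) _ _.
Next Obligation.
by move=> X Y c f h /=; rewrite !vfD !vfZ scalerDr addrACA.
Qed.
Next Obligation.
by move=> X Y f h /=; rewrite !vf_leibniz mulrDl mulrDr addrACA.
Qed.

Program Definition vf_scale (u : C) X := @VectorField (fun f => u * X f) _ _.
Next Obligation.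
by move=> u X c f h /=; rewrite vfD vfZ mulrDr sfun_scalerAr.
Qed.
Next Obligation. by move=> u X f h /=; rewrite vf_leibniz mulrDr mulrA mulrCA. Qed.

Definition vf_opp X := vf_scale (- 1) X.

Fact vf_addA : associative vf_add.
Proof. by move=> X Y Z; apply: vf_ext => f /=; rewrite addrA. Qed.
Fact vf_addC : commutative vf_add.
Proof. by move=> X Y; apply: vf_ext => f /=; rewrite addrC. Qed.
Fact vf_add0 : left_id vf_zero vf_add.
Proof. by move=> X; apply: vf_ext => f /=; rewrite add0r. Qed.
Fact vf_addN : left_inverse vf_zero vf_opp vf_add.
Proof. by move=> X; apply: vf_ext => f /=; rewrite mulN1r addNr. Qed.

HB.instance Definition _ :=
  GRing.isZmodule.Build vector_field vf_addA vf_addC vf_add0 vf_addN.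

Fact vf_scaleA (u v : C) X : vf_scale u (vf_scale v X) = vf_scale (u * v) X.
Proof. by apply: vf_ext => f /=; rewrite mulrA. Qed.
Fact vf_scale1 : left_id 1 vf_scale.
Proof. by move=> X; apply: vf_ext => f /=; rewrite mul1r. Qed.
Fact vf_scaleDr : right_distributive vf_scale +%R.
Proof. by move=> u X Y; apply: vf_ext => f /=; rewrite mulrDr. Qed.
Fact vf_scaleDl X : {morph vf_scale^~ X : u v / u + v}.
Proof. by move=> u v; apply: vf_ext => f /=; rewrite mulrDl. Qed.

HB.instance Definition _ := GRing.Zmodule_isLmodule.Build C vector_field
  vf_scaleA vf_scale1 vf_scaleDr vf_scaleDl.

Let bracket_arith (V : zmodType) (a b c d a' d' : V) :
  a + b + (c + d) - (a' + c + (b + d')) = a - a' + (d - d').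
Proof.
have -> : a + b + (c + d) = (a + d) + (b + c) by rewrite [c + d]addrC addrACA.
have -> : a' + c + (b + d') = (a' + d') + (b + c).
  by rewrite [b + d']addrC addrACA [c + b]addrC.
by rewrite opprD addrACA subrr addr0 opprD addrACA.
Qed.

Program Definition lie_bracket X Y :=
  @VectorField (fun f => X (Y f) - Y (X f)) _ _.
Next Obligation.
by move=> X Y c f h /=; rewrite !vfD !vfZ scalerBr opprD addrACA.
Qed.
Next Obligation.
move=> X Y f h /=; rewrite !vf_leibniz !vfD !vf_leibniz mulrBl mulrBr.
exact: bracket_arith.
Qed.

End VectorFields.

Section Frames.
Variables (R : realType) (n : nat) (M : manifold R n).
Local Notation C := (smooth_fun M).
Local Notation VF := (vector_field M).
Implicit Types X Y Z : VF.

Record tangent_at (p : M) (v : C -> R) : Prop := TangentAt {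
  tangent_linear : forall (c : R) (f h : C), v (c *: f + h) = c * v f + v h;
  tangent_leibniz : forall f h : C, v (f * h) = v f * h p + f p * v h }.

(* The values (E i)_p : f |-> E i f p form a basis of the tangent space. *)
Definition basis_at (p : M) (E : 'I_n -> VF) : Prop :=
  forall v, tangent_at p v ->
    exists! c : 'rV[R]_n, forall f : C, v f = \sum_(i < n) c 0 i * E i f p.

Definition frame (E : 'I_n -> VF) : Prop := forall p, basis_at p E.

(* Trace at p of a C-linear endomorphism A of the module of vector fields: the
   trace of the matrix B of the induced endomorphism of the tangent space at p,
   with respect to some (equivalently, any) basis. *)
Definition trace_at (A : VF -> VF) (p : M) : R :=
  xget 0 [set t | exists (E : 'I_n -> VF) (B : 'M[R]_n),
    [/\ basis_at p E,
        forall j (f : C), A (E j) f p = \sum_(i < n) B i j * E i f p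
      & t = \tr B]].

End Frames.

Section Riemannian.
Variables (R : realType) (n : nat) (M : manifold R n).
Local Notation C := (smooth_fun M).
Local Notation VF := (vector_field M).
Implicit Types X Y Z : VF.

(* Tensor fields are C-multilinear maps on the module of vector fields. The
   last two fields say that g_p is an inner product on the tangent space at p;
   f |-> X f p is the value of X at p, so that [forall f, X f p = 0] means
   X_p = 0. *)
Record riemannian_metric := RiemannianMetric {
  metric :> VF -> VF -> C;
  metric_sym : forall X Y, metric X Y = metric Y X;
  metric_linear : forall (u : C) X Y Z,
    metric (u *: X + Y) Z = u * metric X Z + metric Y Z;
  metric_ge0 : forall X p, 0 <= metric X X p;
  metric_eq0 : forall X p, metric X X p = 0 <-> (forall f : C, X f p = 0) }.

Record affine_connection (nabla : VF -> VF -> VF) : Prop := AffineConnection {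
  nabla_linear : forall (u : C) X Y Z,
    nabla (u *: X + Y) Z = u *: nabla X Z + nabla Y Z;
  nabla_additive : forall X Y Z, nabla X (Y + Z) = nabla X Y + nabla X Z;
  nabla_leibniz : forall (u : C) X Y,
    nabla X (u *: Y) = u *: nabla X Y + X u *: Y }.

Record levi_civita (g : riemannian_metric) (nabla : VF -> VF -> VF) : Prop :=
  LeviCivita {
  levi_civita_connection : affine_connection nabla;
  levi_civita_torsion_free : forall X Y,
    nabla X Y - nabla Y X = lie_bracket X Y;
  levi_civita_metric : forall X Y Z,
    X (g Y Z) = g (nabla X Y) Z + g Y (nabla X Z) }.

Definition curvature (nabla : VF -> VF -> VF) (X Y Z : VF) : VF :=
  nabla X (nabla Y Z) - nabla Y (nabla X Z) - nabla (lie_bracket X Y) Z.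

Definition ricci (nabla : VF -> VF -> VF) (Y Z : VF) : M -> R :=
  trace_at (fun X => curvature nabla X Y Z).

(* nabla is meant to be the Levi-Civita connection of g. *)
Definition einstein (g : riemannian_metric) (nabla : VF -> VF -> VF) (a : R) :=
  forall Y Z p, ricci nabla Y Z p = a * g Y Z p.

End Riemannian.

Section Contact.
Variables (R : realType) (n : nat) (M : manifold R n).
Local Notation C := (smooth_fun M).
Local Notation VF := (vector_field M).
Implicit Types X Y Z : VF.
Variables (phi : VF -> VF) (xi : VF) (eta : VF -> C).
Variables (g : riemannian_metric M) (nabla : VF -> VF -> VF).

Record almost_contact_metric : Prop := AlmostContactMetric {
  acm_phi_linear : linear phi;
  acm_eta_linear : forall (u : C) X Y, eta (u *: X + Y) = u * eta X + eta Y;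
  acm_phi2 : forall X, phi (phi X) = - X + eta X *: xi;
  acm_eta_xi : eta xi = 1;
  acm_phi_xi : phi xi = 0;
  acm_eta_phi : forall X, eta (phi X) = 0;
  acm_metric : forall X Y, g (phi X) (phi Y) = g X Y - eta X * eta Y }.

(* The left-hand side is (nabla_X phi) Y. *)
Definition trans_sasakian (alpha beta : C) : Prop := forall X Y,
  nabla X (phi Y) - phi (nabla X Y) =
    alpha *: (g X Y *: xi - eta Y *: X)
    + beta *: (g (phi X) Y *: xi - eta Y *: phi X).

End Contact.

Local Open Scope complex_scope.

(* For a real module V, the complexification of V is [V[i]], the type of formal
   sums [x +i* y]; complex-valued smooth functions are [(smooth_fun M)[i]] and
   complex vector fields [(vector_field M)[i]]. *)

Definition clift (V : zmodType) (x : V) : V[i] := x +i* 0.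
Definition cmuli (V : zmodType) (z : V[i]) : V[i] :=
  - complex.Im z +i* complex.Re z.
Definition cneg (V : zmodType) (z : V[i]) : V[i] :=
  - complex.Re z +i* - complex.Im z.
Definition cconj (V : zmodType) (z : V[i]) : V[i] :=
  complex.Re z +i* - complex.Im z.

Definition clin (V W : Type) (A : V -> W) (z : V[i]) : W[i] :=
  A (complex.Re z) +i* A (complex.Im z).
Definition cbilin (U V : Type) (W : zmodType) (B : U -> V -> W)
    (x : U[i]) (y : V[i]) : W[i] :=
  (B (complex.Re x) (complex.Re y) - B (complex.Im x) (complex.Im y))
  +i* (B (complex.Re x) (complex.Im y) + B (complex.Im x) (complex.Re y)).

Section NewmanPenrose.
Variables (R : realType) (M : manifold R 3).
Local Notation C := (smooth_fun M).
Local Notation VF := (vector_field M).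

Definition cvalue (f : C[i]) (p : M) : R[i] :=
  complex.Re f p +i* complex.Im f p.

Definition cderiv (Z : VF[i]) (f : C[i]) : C[i] :=
  cbilin (fun (X : VF) (h : C) => X h) Z f.

Definition frame3 (e1 e2 xi : VF) (i : 'I_3) : VF := tnth [tuple e1; e2; xi] i.

Definition np_d (e1 e2 : VF) : VF[i] :=
  let s := smooth_const M (Num.sqrt 2)^-1 in (s *: e1) +i* - (s *: e2).
Definition np_dbar (e1 e2 : VF) : VF[i] :=
  let s := smooth_const M (Num.sqrt 2)^-1 in (s *: e1) +i* (s *: e2).

Record np_frame (phi : VF -> VF) (g : riemannian_metric M) (e1 e2 xi : VF) :
    Prop := NPFrame {
  np_is_frame : frame (frame3 e1 e2 xi);
  np_orthonormal : forall i j : 'I_3,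
    g (frame3 e1 e2 xi i) (frame3 e1 e2 xi j) = (i == j)%:R;
  np_phi_d : clin phi (np_d e1 e2) = cmuli (np_d e1 e2);
  np_phi_dbar : clin phi (np_dbar e1 e2) = cneg (cmuli (np_dbar e1 e2)) }.

Section SpinCoefficients.
Variables (g : riemannian_metric M) (nabla : VF -> VF -> VF).
Variables (d dbar xi : VF[i]).
Local Notation cg := (cbilin g).
Local Notation cnabla := (cbilin nabla).

Definition rho_np : C[i] := cg d (cnabla dbar xi).
Definition beta_np : C[i] := cg dbar (cnabla d d).
Definition epsilon_np : C[i] := cg dbar (cnabla xi d).

End SpinCoefficients.

End NewmanPenrose.

(* Main.v *)
(* In the frame (e1, e2, xi) the trans-Sasakian condition gives
   nabla_X xi = beta (X - eta(X) xi) - alpha phi X, so the connection is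
   determined by alpha, beta and the three functions
   p, q, r = g(nabla_X e1, e2) for X = e1, e2, xi. Here
     rho = beta + i alpha, beta_np = (q + i p) / sqrt 2, epsilon = i r,
   and the Ricci tensor is
     S(e1, e1) = S(e2, e2) = K + k, S(xi, xi) = 2 k, S(e1, e2) = 0,
     S(e1, xi) = - (e1 beta + e2 alpha), S(e2, xi) = e1 alpha - e2 beta,
   with K and k the sectional curvatures of (e1, e2) and (e1, xi). The pair
   symmetry of the curvature tensor yields xi(alpha) + 2 alpha beta = 0, that is
   Im (xi(rho) + rho^2) = 0, so both complex expressions of the theorem are
   real; they are S(e1, e1) and S(xi, xi), while d(rho) encodes S(e_i, xi). *)
Require Import Defs.
From mathcomp Require Import all_boot all_order all_algebra.
From mathcomp Require Import all_classical all_reals all_analysis.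
From mathcomp Require Import complex ring lra.
Import Order.TTheory GRing.Theory Num.Theory.
Local Open Scope ring_scope.
Local Open Scope complex_scope.

(** * Pointwise evaluation of smooth functions *)

Section SmoothFunctions.
Context {R : realType} {n : nat} {M : manifold R n}.
Implicit Types (f h : smooth_fun M) (p : M).

Lemma sfun_ext f h : (forall p, f p = h p) -> f = h.
Proof. by move=> fh; apply/val_inj/funext. Qed.

Lemma sfunD f h p : (f + h) p = f p + h p. Proof. by []. Qed.
Lemma sfunB f h p : (f - h) p = f p - h p. Proof. by []. Qed.
Lemma sfunN f p : (- f) p = - f p. Proof. by []. Qed.
Lemma sfunM f h p : (f * h) p = f p * h p. Proof. by []. Qed.
Lemma sfun0 p : (0 : smooth_fun M) p = 0. Proof. by []. Qed.
Lemma sfun1 p : (1 : smooth_fun M) p = 1. Proof. by []. Qed.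
Lemma sfun_const (c : R) p : smooth_const M c p = c.
Proof. exact: mulr1. Qed.
Lemma sfun_sum (I : finType) (F : I -> smooth_fun M) p :
  (\sum_i F i) p = \sum_i F i p.
Proof.
exact: (big_morph (fun f : smooth_fun M => f p) (fun f h => sfunD f h p)
  (sfun0 p)).
Qed.

Definition sfunE := (sfunD, sfunN, sfunM, sfun0, sfun1, sfun_const).

End SmoothFunctions.

(** * Vector fields as derivations *)

Section VectorFields.
Context {R : realType} {n : nat} {M : manifold R n}.
Local Notation C := (smooth_fun M).
Local Notation VF := (vector_field M).
Implicit Types (X Y Z W : VF) (f h u : C) (p : M).

Lemma vfieldD X Y f : (X + Y) f = X f + Y f. Proof. by []. Qed.
Lemma vfieldN X f : (- X) f = - X f :> C.
Proof. exact: mulN1r. Qed.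
Lemma vfieldZ u X f : (u *: X) f = u * X f. Proof. by []. Qed.
Lemma vfield0 f : (0 : VF) f = 0. Proof. by []. Qed.
Lemma vfield_sum (I : finType) (F : I -> VF) f : (\sum_i F i) f = \sum_i F i f.
Proof.
exact: (big_morph (fun X : VF => X f) (fun X Y => vfieldD X Y f) (vfield0 f)).
Qed.
Lemma lie_bracketE X Y f : lie_bracket X Y f = X (Y f) - Y (X f).
Proof. by []. Qed.

Lemma vfN X f : X (- f) = - X f :> C.
Proof. by rewrite -sub0r vfB vf0 sub0r. Qed.

Lemma vf1 X : X 1 = 0.
Proof.
have := vf_leibniz X 1 1; rewrite !mulr1 mul1r => H.
by apply: (@addrI _ (X 1)); rewrite addr0 -H.
Qed.

Lemma vf_const X (c : R) : X (smooth_const M c) = 0.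
Proof. by rewrite /smooth_const vfZ vf1 scaler0. Qed.

End VectorFields.

(** * Metric algebra, orthonormal expansion and the trace *)

Section Metric.
Context {R : realType} {n : nat} {M : manifold R n} {g : riemannian_metric M}.
Local Notation C := (smooth_fun M).
Local Notation VF := (vector_field M).
Implicit Types (X Y Z W : VF) (f h u : C) (p : M).

Lemma metricC X Y : g X Y = g Y X.
Proof. exact: Defs.metric_sym. Qed.
Lemma metricDl X Y Z : g (X + Y) Z = g X Z + g Y Z.
Proof. by rewrite -[X]scale1r metric_linear mul1r scale1r. Qed.
Lemma metric0l Z : g 0 Z = 0.
Proof. by apply: (@addrI _ (g 0 Z)); rewrite -metricDl !addr0. Qed.
Lemma metricZl u X Z : g (u *: X) Z = u * g X Z.
Proof. by rewrite -[u *: X]addr0 metric_linear metric0l addr0. Qed.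
Lemma metricNl X Z : g (- X) Z = - g X Z :> C.
Proof. by rewrite -scaleN1r metricZl mulN1r. Qed.
Lemma metricDr X Y Z : g Z (X + Y) = g Z X + g Z Y.
Proof. by rewrite !(metricC Z) metricDl. Qed.
Lemma metric0r Z : g Z 0 = 0.
Proof. by rewrite metricC metric0l. Qed.
Lemma metricZr u X Z : g Z (u *: X) = u * g Z X.
Proof. by rewrite !(metricC Z) metricZl. Qed.
Lemma metricNr X Z : g Z (- X) = - g Z X :> C.
Proof. by rewrite !(metricC Z) metricNl. Qed.
Lemma metric_suml (I : finType) (F : I -> VF) Z :
  g (\sum_i F i) Z = \sum_i g (F i) Z.
Proof.
exact: (big_morph (fun X => g X Z) (fun X Y => metricDl X Y Z) (metric0l Z)).
Qed.

Definition metricE := (metricDl, metricZl, metricNl, metric0l,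
  metricDr, metricZr, metricNr, metric0r).

(* At p, g(Z + cX, Z + cX) is nonnegative and affine in the constant c, since
   its quadratic coefficient vanishes; hence its slope 2 g(X, Z) is 0. *)
Lemma metric_eq0l X Z p : (forall f, X f p = 0) -> g X Z p = 0.
Proof.
move=> /(metric_eq0 g X p) X0.
have pos (c : R) : 0 <= g Z Z p + 2 * c * g X Z p.
  have := metric_ge0 g (Z + smooth_const M c *: X) p.
  rewrite !metricE !sfunE (metricC Z X) X0.
  by congr (_ <= _); ring.
apply/eqP; apply: contraT => b0.
have := pos (- (g Z Z p + 1) / (2 * g X Z p)).
have -> : g Z Z p + 2 * (- (g Z Z p + 1) / (2 * g X Z p)) * g X Z p = -1.
  by field; exact: b0.
lra.
Qed.

(** This locality allows a field to be replaced, at one point, by a combination of frame fields with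
    constant coefficients. *)
Lemma eq_metricl X Y Z p : (forall f, X f p = Y f p) -> g X Z p = g Y Z p.
Proof.
move=> XY; apply/eqP; rewrite -subr_eq0 -sfunB -metricNl -metricDl; apply/eqP.
by apply: metric_eq0l => f; rewrite vfieldD vfieldN !sfunE XY subrr.
Qed.

Lemma vfield_tangent X p : tangent_at p (fun f => X f p).
Proof.
split=> [c f h|f h]; last by rewrite vf_leibniz !sfunE.
by rewrite vfD vfZ.
Qed.

Section OrthonormalFrame.
Context {E : 'I_n -> VF}.
Hypothesis frE : frame E.
Hypothesis onE : forall i j, g (E i) (E j) = (i == j)%:R.

(** The basis property gives real coefficients at each point; pairing with [E i] identifies them as
    values of the smooth functions [g X (E i)]. *)
Lemma frame_expansion X : X = \sum_i g X (E i) *: E i.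
Proof.
apply: vf_ext => f; apply: sfun_ext => p.
have [c [cE _]] := frE p _ (vfield_tangent X p).
rewrite vfield_sum sfun_sum cE; apply: eq_bigr => i _.
rewrite vfieldZ sfunE; congr (_ * _).
rewrite (@eq_metricl _ (\sum_j smooth_const M (c 0 j) *: E j)).
  rewrite metric_suml sfun_sum (bigD1 i) //= metricZl onE eqxx mulr1 sfun_const.
  rewrite big1 ?addr0 // => j ji.
  by rewrite metricZl onE (negPf ji) mulr0 sfun0.
move=> h; rewrite cE vfield_sum sfun_sum; apply: eq_bigr => j _.
by rewrite vfieldZ sfunE sfun_const.
Qed.

(** The trace is invariant under change of basis, so whichever basis [xget] selects can be compared
    with [E]. Linearity of [A] is stated after pairing with [W], the form in which the curvature
    supplies it. *)
Lemma trace_atE (A : VF -> VF) p :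
  (forall u X Y W, g (A (u *: X + Y)) W = u * g (A X) W + g (A Y) W) ->
  trace_at A p = \sum_i g (A (E i)) (E i) p.
Proof.
move=> linA; rewrite /trace_at.
have AD X Y W : g (A (X + Y)) W = g (A X) W + g (A Y) W.
  by rewrite -[X]scale1r linA mul1r scale1r.
have A0 W : g (A 0) W = 0.
  by apply: (@addrI _ (g (A 0) W)); rewrite -AD !addr0.
have Asum (F : 'I_n -> VF) W : g (A (\sum_i F i)) W = \sum_i g (A (F i)) W.
  elim/big_rec2: _ => [|i x Y _ <-]; [exact: A0 | exact: AD].
have AZ u X W : g (A (u *: X)) W = u * g (A X) W.
  by rewrite -[u *: X]addr0 linA A0 addr0.
case: xgetP => [_ _ [F [B [bF AF ->]]]|/(_ (\sum_i g (A (E i)) (E i) p)) []].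
  (* [P] expresses the chosen basis [F] in the frame [E], and [T] is the matrix of [A] in [E] with
     rows as images; [P *m T] and [B^T *m P] both collect the components of the [A (F j)] along
     [E]. *)
  pose P := \matrix_(j, k) g (F j) (E k) p.
  pose T := \matrix_(k, l) g (A (E k)) (E l) p.
  have PT : P *m T = B^T *m P.
    apply/matrixP => j l; rewrite !mxE.
    transitivity (g (A (F j)) (E l) p).
      rewrite [in RHS](frame_expansion (F j)) Asum sfun_sum.
      by apply: eq_bigr => k _; rewrite AZ sfunM !mxE.
    rewrite (@eq_metricl _ (\sum_i smooth_const M (B i j) *: F i)).
      rewrite metric_suml sfun_sum; apply: eq_bigr => i _.
      by rewrite metricZl sfunM sfun_const !mxE.
    move=> f; rewrite AF vfield_sum sfun_sum; apply: eq_bigr => i _.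
    by rewrite vfieldZ sfunM sfun_const.
  (* The coordinates of [E] in the basis [F] form the inverse of [P], so [T] is conjugate to
     [B^T]. *)
  have /choice[c cP] k : exists c : 'rV[R]_n,
      forall f, E k f p = \sum_i c 0 i * F i f p.
    by have [c [cP _]] := bF _ (vfield_tangent (E k) p); exists c.
  have QP : (\matrix_(k, i) c k 0 i) *m P = 1%:M.
    apply/matrixP => k l; rewrite !mxE.
    transitivity (g (E k) (E l) p); last by rewrite onE; case: (k == l).
    rewrite (@eq_metricl _ (\sum_i smooth_const M (c k 0 i) *: F i)).
      rewrite metric_suml sfun_sum; apply: eq_bigr => i _.
      by rewrite metricZl sfunM sfun_const !mxE.
    move=> f; rewrite cP vfield_sum sfun_sum; apply: eq_bigr => i _.
    by rewrite vfieldZ sfunM sfun_const.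
  transitivity (\tr T); last by apply: eq_bigr => i _; rewrite mxE.
  rewrite -[T]mul1mx -QP -mulmxA PT mulmxA mxtrace_mulC mulmxA.
  by rewrite (mulmx1C QP) mul1mx mxtrace_tr.
(* The frame [E] itself is an admissible basis, so [xget] never falls back on its default 0. *)
exists E, (\matrix_(i, j) g (A (E j)) (E i) p); split=> //.
- move=> j f; rewrite [A (E j)]frame_expansion vfield_sum sfun_sum.
  by apply: eq_bigr => i _; rewrite vfieldZ sfunM mxE.
- by apply: eq_bigr => i _; rewrite mxE.
Qed.

End OrthonormalFrame.
End Metric.

(** * Symmetries of the curvature tensor of the Levi-Civita connection *)

Section Curvature.
Context {R : realType} {n : nat} {M : manifold R n} {g : riemannian_metric M}.
Local Notation C := (smooth_fun M).
Local Notation VF := (vector_field M).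
Context {nabla : VF -> VF -> VF}.
Hypothesis lc : levi_civita g nabla.
Implicit Types (X Y Z W : VF) (f h u : C) (p : M).

Let ac := levi_civita_connection lc.

Lemma nablaDl X Y Z : nabla (X + Y) Z = nabla X Z + nabla Y Z.
Proof. by rewrite -[X]scale1r nabla_linear // !scale1r. Qed.
Lemma nabla0l Z : nabla 0 Z = 0.
Proof. by apply: (@addrI _ (nabla 0 Z)); rewrite -nablaDl !addr0. Qed.
Lemma nablaZl u X Z : nabla (u *: X) Z = u *: nabla X Z.
Proof. by rewrite -[u *: X]addr0 nabla_linear // nabla0l addr0. Qed.
Lemma nablaNl X Z : nabla (- X) Z = - nabla X Z.
Proof. by rewrite -scaleN1r nablaZl scaleN1r. Qed.
Lemma nablaDr X Y Z : nabla Z (X + Y) = nabla Z X + nabla Z Y.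
Proof. exact: nabla_additive. Qed.
Lemma nabla0r Z : nabla Z 0 = 0.
Proof. by apply: (@addrI _ (nabla Z 0)); rewrite -nablaDr !addr0. Qed.
Lemma nablaZr u X Z : nabla Z (u *: X) = u *: nabla Z X + Z u *: X.
Proof. exact: nabla_leibniz. Qed.
Lemma nablaNr X Z : nabla Z (- X) = - nabla Z X.
Proof.
by apply: (@addrI _ (nabla Z X)); rewrite -nablaDr !subrr nabla0r.
Qed.

Definition nablaE := (nablaDl, nablaZl, nablaNl, nabla0l,
  nablaDr, nablaZr, nablaNr, nabla0r).

Lemma torsion_free X Y : lie_bracket X Y = nabla X Y - nabla Y X.
Proof. by rewrite (levi_civita_torsion_free lc). Qed.

Lemma metric_nabla X Y Z : g (nabla X Y) Z = X (g Y Z) - g Y (nabla X Z).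
Proof. by rewrite (levi_civita_metric lc) addrK. Qed.

Definition riem X Y Z W : C := g (curvature nabla X Y Z) W.

(** Vanishing torsion trades the bracket for covariant derivatives, leaving an expression computable
    from a table of [nabla] on a frame. *)
Lemma riemE X Y Z W : riem X Y Z W =
  g (nabla X (nabla Y Z)) W - g (nabla Y (nabla X Z)) W
  - g (nabla (nabla X Y) Z) W + g (nabla (nabla Y X) Z) W.
Proof.
rewrite /riem /curvature torsion_free !nablaE !metricE.
by apply: sfun_ext => p; rewrite !sfunE; ring.
Qed.

Lemma riem_linear1 u X X' Y Z W :
  riem (u *: X + X') Y Z W = u * riem X Y Z W + riem X' Y Z W.
Proof.
rewrite !riemE !nablaE !metricE.
by apply: sfun_ext => p; rewrite !sfunE; ring.
Qed.

Lemma riem_antisym12 X Y Z W : riem X Y Z W = - riem Y X Z W :> C.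
Proof. by rewrite !riemE; apply: sfun_ext => p; rewrite !sfunE; ring. Qed.

(** Metric compatibility expands both sides of [X,Y] g(Z,W) = X (Y g(Z,W)) - Y (X g(Z,W)); the
    products of first derivatives cancel in the commutator. *)
Lemma riem_antisym34 X Y Z W : riem X Y Z W = - riem X Y W Z :> C.
Proof.
apply: sfun_ext => p.
have brE := lie_bracketE X Y (g Z W).
rewrite !(levi_civita_metric lc, vfD, torsion_free) in brE.
move: brE => /(congr1 (fun f : C => f p)).
rewrite /riem /curvature torsion_free !nablaE !metricE.
rewrite !(metricC Z) !sfunE; lra.
Qed.

Lemma jacobi X Y Z : lie_bracket X (lie_bracket Y Z)
  + lie_bracket Y (lie_bracket Z X) + lie_bracket Z (lie_bracket X Y) = 0.
Proof.
apply: vf_ext => f; rewrite !vfieldD !lie_bracketE !vfB.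
by apply: sfun_ext => p; rewrite !sfunE; ring.
Qed.

(** This is the Jacobi identity paired with [W], once torsion-freeness has rewritten every bracket
    by [nabla]. *)
Lemma riem_bianchi X Y Z W : riem X Y Z W + riem Y Z X W + riem Z X Y W = 0.
Proof.
have : g _ W = g 0 W := congr1 (fun V => g V W) (jacobi X Y Z).
rewrite !torsion_free !nablaE !metricE => H.
apply: sfun_ext => p; move/(congr1 (fun f : C => f p)): H.
rewrite !riemE !sfunE; lra.
Qed.

(** The classical octahedron argument: a linear combination of four Bianchi identities, one for each
    cyclic shift of the arguments. *)
Lemma riem_pair_sym X Y Z W : riem X Y Z W = riem Z W X Y.
Proof.
apply: sfun_ext => p.
have b X' Y' Z' W' :
    riem X' Y' Z' W' p + riem Y' Z' X' W' p + riem Z' X' Y' W' p = 0.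
  by rewrite -!sfunD riem_bianchi.
have a1 X' Y' Z' W' : riem X' Y' Z' W' p = - riem Y' X' Z' W' p.
  by rewrite riem_antisym12.
have a2 X' Y' Z' W' : riem X' Y' Z' W' p = - riem X' Y' W' Z' p.
  by rewrite riem_antisym34.
move: (b X Y Z W) (b Y Z W X) (b Z W X Y) (b W X Y Z).
(* Components equal up to antisymmetry are brought to a common form, so that what remains is
   linear. *)
rewrite (a2 X Y W Z) (a2 Z W Y X) (a2 Y Z W X) (a2 W X Z Y).
rewrite (a1 Z X Y W) (a2 X Z Y W) (a1 W Y Z X) (a2 Y W Z X).
lra.
Qed.

Lemma riem_linear2 u X Y Y' Z W :
  riem X (u *: Y + Y') Z W = u * riem X Y Z W + riem X Y' Z W.
Proof.
rewrite !(riem_antisym12 X) riem_linear1.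
by apply: sfun_ext => p; rewrite !sfunE; ring.
Qed.

(** * The Ricci tensor as a frame trace *)

Section Ricci.
Context {E : 'I_n -> VF}.
Hypothesis frE : frame E.
Hypothesis onE : forall i j, g (E i) (E j) = (i == j)%:R.

Definition ric Y Z : C := \sum_k riem (E k) Y Z (E k).

Lemma ricciE Y Z p : ricci nabla Y Z p = ric Y Z p.
Proof.
rewrite /ricci (trace_atE frE onE) ?sfun_sum // => u X X' W.
exact: riem_linear1.
Qed.

(** Pair symmetry exchanges [Y] and [Z], and the two antisymmetries restore the order of the
    arguments with cancelling signs. *)
Lemma ric_sym Y Z : ric Y Z = ric Z Y.
Proof.
apply: eq_bigr => k _; rewrite riem_pair_sym riem_antisym12 riem_antisym34.
exact: opprK.
Qed.

Lemma ric_linear u Y Y' Z : ric (u *: Y + Y') Z = u * ric Y Z + ric Y' Z.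
Proof.
rewrite /ric mulr_sumr -big_split; apply: eq_bigr => k _; exact: riem_linear2.
Qed.

Lemma ric_sumZ (u : 'I_n -> C) Z :
  ric (\sum_i u i *: E i) Z = \sum_i u i * ric (E i) Z.
Proof.
have ric0 : ric 0 Z = 0.
  apply: (@addrI _ (ric 0 Z)).
  by rewrite -{1}[ric 0 Z]mul1r -ric_linear scaler0 !addr0.
elim/big_rec2: _ => [|i x Y _ <-]; [exact: ric0 | exact: ric_linear].
Qed.

(** Linearity in the first argument and symmetry make [ric] bilinear over smooth functions, so the
    Einstein equation can be tested on pairs of frame fields. *)
Lemma einstein_frame (a : R) : einstein g nabla a <->
  forall i j p, ric (E i) (E j) p = a * (i == j)%:R.
Proof.
split=> [eing i j p | ricE Y Z p].
  by rewrite -ricciE eing onE; case: (i == j).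
rewrite ricciE (frame_expansion frE onE Y) ric_sumZ metric_suml.
rewrite !sfun_sum mulr_sumr.
apply: eq_bigr => i _; rewrite metricZl !sfunM mulrCA; congr (_ * _).
rewrite ric_sym metricC (frame_expansion frE onE Z) ric_sumZ metric_suml.
rewrite !sfun_sum mulr_sumr; apply: eq_bigr => j _.
rewrite metricZl !sfunM mulrCA ricE onE; congr (_ * (_ * _)).
by case: (j == i).
Qed.

End Ricci.
End Curvature.

(** * Orthonormal frames in dimension three *)

Section Frame3.
Context {R : realType} {M : manifold R 3} {g : riemannian_metric M}.
Local Notation C := (smooth_fun M).
Local Notation VF := (vector_field M).
Context {nabla : VF -> VF -> VF} {e1 e2 xi : VF}.
Hypothesis lc : levi_civita g nabla.
Hypothesis frE : frame (frame3 e1 e2 xi).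
Hypothesis onE : forall i j : 'I_3,
  g (frame3 e1 e2 xi i) (frame3 e1 e2 xi j) = (i == j)%:R.
Implicit Types (X Y Z W : VF) (f h u : C).

Let i0 : 'I_3 := ord0.
Let i1 : 'I_3 := lift ord0 ord0.
Let i2 : 'I_3 := lift ord0 (lift ord0 ord0).

Lemma metric_e11 : g e1 e1 = 1. Proof. exact: (onE i0 i0). Qed.
Lemma metric_e12 : g e1 e2 = 0. Proof. exact: (onE i0 i1). Qed.
Lemma metric_e13 : g e1 xi = 0. Proof. exact: (onE i0 i2). Qed.
Lemma metric_e21 : g e2 e1 = 0. Proof. exact: (onE i1 i0). Qed.
Lemma metric_e22 : g e2 e2 = 1. Proof. exact: (onE i1 i1). Qed.
Lemma metric_e23 : g e2 xi = 0. Proof. exact: (onE i1 i2). Qed.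
Lemma metric_e31 : g xi e1 = 0. Proof. exact: (onE i2 i0). Qed.
Lemma metric_e32 : g xi e2 = 0. Proof. exact: (onE i2 i1). Qed.
Lemma metric_e33 : g xi xi = 1. Proof. exact: (onE i2 i2). Qed.

Definition metric_frameE := (metric_e11, metric_e12, metric_e13,
  metric_e21, metric_e22, metric_e23, metric_e31, metric_e32, metric_e33).

Lemma frame3_expansion X : X = g X e1 *: e1 + g X e2 *: e2 + g X xi *: xi.
Proof.
by rewrite {1}(frame_expansion frE onE X) !big_ord_recl big_ord0 addr0 addrA.
Qed.

Local Notation rm := (riem (g := g) (nabla := nabla)).
Local Notation rc := (ric (g := g) (nabla := nabla) (E := frame3 e1 e2 xi)).

Lemma ric_frame3 Y Z :
  rc Y Z = rm e1 Y Z e1 + rm e2 Y Z e2 + rm xi Y Z xi.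
Proof. by rewrite /ric !big_ord_recl big_ord0 addr0 addrA. Qed.

Lemma metric_nabla_self X Y : g Y Y = 1 -> g (nabla X Y) Y = 0.
Proof.
move=> Y1; apply: sfun_ext => p.
have := congr1 (fun f : C => f p) (levi_civita_metric lc X Y Y).
rewrite Y1 vf1 (metricC Y) !sfunE; lra.
Qed.

Lemma metric_nabla_swap X Y Z :
  g Y Z = 0 -> g (nabla X Y) Z = - g (nabla X Z) Y :> C.
Proof. by move=> YZ; rewrite (metric_nabla lc) YZ vf0 sub0r metricC. Qed.

(** * Curvature and Ricci components from the structure equations *)

Section StructureEquations.
Variables p q r al be : C.
Hypothesis n11 : nabla e1 e1 = p *: e2 + (- be) *: xi.
Hypothesis n12 : nabla e1 e2 = (- p) *: e1 + al *: xi.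
Hypothesis n13 : nabla e1 xi = be *: e1 + (- al) *: e2.
Hypothesis n21 : nabla e2 e1 = q *: e2 + (- al) *: xi.
Hypothesis n22 : nabla e2 e2 = (- q) *: e1 + (- be) *: xi.
Hypothesis n23 : nabla e2 xi = al *: e1 + be *: e2.
Hypothesis n31 : nabla xi e1 = r *: e2.
Hypothesis n32 : nabla xi e2 = (- r) *: e1.
Hypothesis n33 : nabla xi xi = 0.

Let nE := (n11, n12, n13, n21, n22, n23, n31, n32, n33).

(** Expanding both covariant derivatives in the frame and applying orthonormality leaves a
    polynomial identity in the coefficients and their derivatives. *)
Ltac compute_riem :=
  rewrite (riemE lc) !(nE, nablaE lc) !(metricE, metric_frameE, vfN);
  apply: sfun_ext => x; rewrite !sfunE; ring.

Lemma riem1331 : rm e1 xi xi e1 = - xi be - be * be + al * al.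
Proof. compute_riem. Qed.
Lemma riem1332 : rm e1 xi xi e2 = xi al + (al * be + al * be).
Proof. compute_riem. Qed.
(** The value is opposite to that of [riem1332], although the curvature symmetries force the two
    components to agree. *)
Lemma riem2331 : rm e2 xi xi e1 = - (xi al + (al * be + al * be)) :> C.
Proof. compute_riem. Qed.
Lemma riem2332 : rm e2 xi xi e2 = - xi be - be * be + al * al.
Proof. compute_riem. Qed.
Lemma riem1231 : rm e1 e2 xi e1 = e1 al - e2 be.
Proof. compute_riem. Qed.
Lemma riem1232 : rm e1 e2 xi e2 = e1 be + e2 al.
Proof. compute_riem. Qed.
Lemma riem1221 : rm e1 e2 e2 e1 =
  - al * al - be * be - p * p - q * q + (al * r + al * r) - e1 q + e2 p.
Proof. compute_riem. Qed.

(* The pair symmetry of the curvature, applied to [riem e1 xi xi e2]. *)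
Lemma xi_al : xi al + (al * be + al * be) = 0.
Proof.
apply: sfun_ext => x; move: (riem_pair_sym lc e1 xi xi e2).
rewrite (riem_antisym12 lc xi) (riem_antisym34 lc e2) opprK riem1332 riem2331.
by move=> /(congr1 (fun f : C => f x)); rewrite !sfunE; lra.
Qed.

(** Of the six independent Ricci components, S(e1,e2) vanishes and S(e1,e1) equals S(e2,e2), which
    leaves four conditions. *)
Lemma einstein_structure (a : R) : einstein g nabla a <-> forall x,
  [/\ (- al * al - be * be - p * p - q * q + (al * r + al * r) - e1 q + e2 p
       - xi be - be * be + al * al) x = a,
      (- xi be - be * be + al * al) x *+ 2 = a,
      e1 be x + e2 al x = 0 & e1 al x - e2 be x = 0].
Proof.
have rmxx X Y Z : rm X X Y Z = 0.
  apply: sfun_ext => x; have := riem_antisym12 lc X X Y Z.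
  by move=> /(congr1 (fun f : C => f x)); rewrite !sfunE; lra.
have rmzz X Y Z : rm X Y Z Z = 0 by rewrite (riem_pair_sym lc) rmxx.
have S11 : rc e1 e1 =
  - al * al - be * be - p * p - q * q + (al * r + al * r) - e1 q + e2 p
       - xi be - be * be + al * al.
  rewrite ric_frame3 rmxx (riem_pair_sym lc e2) riem1221.
  rewrite (riem_pair_sym lc xi) riem1331.
  by apply: sfun_ext => x; rewrite !sfunE; ring.
(* The only surviving term is the curvature component that [xi_al] annihilates. *)
have S12 : rc e1 e2 = 0.
  rewrite ric_frame3 rmxx rmzz (riem_antisym12 lc) (riem_antisym34 lc) opprK.
  by rewrite riem1332 xi_al !addr0.
have S13 : rc e1 xi = - (e1 be + e2 al) :> C.
  by rewrite ric_frame3 rmxx rmzz (riem_antisym12 lc) riem1232 add0r addr0.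
have S22 : rc e2 e2 =
  - al * al - be * be - p * p - q * q + (al * r + al * r) - e1 q + e2 p
       - xi be - be * be + al * al.
  rewrite ric_frame3 rmxx riem1221 (riem_pair_sym lc xi) riem2332.
  by apply: sfun_ext => x; rewrite !sfunE; ring.
have S23 : rc e2 xi = e1 al - e2 be.
  by rewrite ric_frame3 rmxx rmzz riem1231 !addr0.
have S33 : rc xi xi =
    (- xi be - be * be + al * al) *+ 2.
  by rewrite ric_frame3 rmxx riem1331 riem2332 addr0.
rewrite (einstein_frame lc frE onE); split=> [ein x | ein].
  (* The casts evaluate the Kronecker delta by conversion. *)
  move: (ein i0 i0 x : _ = a * 1) (ein i2 i2 x : _ = a * 1).
  move: (ein i0 i2 x : _ = a * 0) (ein i1 i2 x : _ = a * 0).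
  rewrite S11 S33 S13 S23 mulr1 mulr0 => E13 E23 E11 E33.
  by split=> //; apply/eqP; rewrite -oppr_eq0 -E13.
have c11 x : rc e1 e1 x = a * 1.
  by rewrite S11 mulr1; case: (ein x).
have c12 x : rc e1 e2 x = a * 0.
  by rewrite S12 mulr0.
have c13 x : rc e1 xi x = a * 0.
  by rewrite S13 mulr0 !sfunE; case: (ein x) => _ _ -> _; rewrite oppr0.
have c22 x : rc e2 e2 x = a * 1.
  by rewrite S22 mulr1; case: (ein x).
have c23 x : rc e2 xi x = a * 0.
  by rewrite S23 mulr0; case: (ein x).
have c33 x : rc xi xi x = a * 1.
  by rewrite S33 mulr1; case: (ein x).
(* Six of the nine index pairs are listed above; the other three follow by symmetry. *)
by case=> [[|[|[|//]]] ?] [[|[|[|//]]] ?] x; rewrite // (ric_sym lc).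
Qed.

End StructureEquations.
End Frame3.

(** * The connection of a trans-Sasakian manifold in the given frame *)

Section TransSasakian.
Context {R : realType} {M : manifold R 3} {g : riemannian_metric M}.
Local Notation C := (smooth_fun M).
Local Notation VF := (vector_field M).
Context {nabla : VF -> VF -> VF} {phi : VF -> VF} {eta : VF -> C}.
Context {e1 e2 xi : VF} {al be : C}.
Hypothesis acm : almost_contact_metric phi xi eta g.
Hypothesis lc : levi_civita g nabla.
Hypothesis ts : trans_sasakian phi xi eta g nabla al be.
Hypothesis npf : np_frame phi g e1 e2 xi.
Implicit Types (X Y Z W : VF) (f h u : C).

Let frE := np_is_frame npf.
Let onE := np_orthonormal npf.

Lemma acm_phiD X Y : phi (X + Y) = phi X + phi Y.
Proof. by have := acm_phi_linear acm 1 X Y; rewrite !scale1r. Qed.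
Lemma acm_phi0 : phi 0 = 0.
Proof. by apply: (@addrI _ (phi 0)); rewrite -acm_phiD !addr0. Qed.
Lemma acm_phiZ u X : phi (u *: X) = u *: phi X.
Proof. by have := acm_phi_linear acm u X 0; rewrite acm_phi0 !addr0. Qed.
Lemma acm_phiN X : phi (- X) = - phi X.
Proof. by rewrite -scaleN1r acm_phiZ scaleN1r. Qed.

(** In the compatibility of [g] with [phi], taking [xi] as second argument kills the left-hand
    side. *)
Lemma acm_etaE X : eta X = g X xi.
Proof.
have := acm_metric acm X xi.
rewrite (acm_phi_xi acm) metric0r (acm_eta_xi acm) mulr1.
by move/eqP; rewrite eq_sym subr_eq0 => /eqP.
Qed.

(** Apply [phi] to the trans-Sasakian identity at [xi]: the left side becomes - phi^2 (nabla_X xi),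
    which is nabla_X xi because the unit field [xi] is orthogonal to its derivatives. *)
Lemma nabla_xi X : nabla X xi = be *: (X - g X xi *: xi) - al *: phi X.
Proof.
have := congr1 phi (ts X xi).
rewrite (acm_phi_xi acm) (nabla0r lc) sub0r.
rewrite !(acm_phiD, acm_phiZ, acm_phiN) !(acm_phi2 acm) (acm_phi_xi acm).
rewrite !acm_etaE (metric_nabla_self lc) ?(metric_e33 onE) //.
rewrite -(acm_etaE (phi X)) (acm_eta_phi acm) => H.
apply: vf_ext => f; apply: sfun_ext => x.
have {H} := congr1 (fun V : VF => V f x) H.
by rewrite !(vfieldD, vfieldN, vfieldZ, vfield0, sfunE); lra.
Qed.

Let s : C := smooth_const M (Num.sqrt 2)^-1.

Lemma sqrt2V_sqr : (Num.sqrt 2)^-1 * (Num.sqrt 2)^-1 = 2^-1 :> R.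
Proof. by rewrite -invfM -expr2 sqr_sqrtr ?ler0n. Qed.

Lemma scale_sqrt2VI X Y : s *: X = s *: Y -> X = Y.
Proof.
move=> /(congr1 (fun Z => smooth_const M (Num.sqrt 2) *: Z)).
rewrite !scalerA (_ : smooth_const M (Num.sqrt 2) * s = 1) ?scale1r //.
apply: sfun_ext => x; rewrite !sfunE divff // sqrtr_eq0 -ltNge.
Qed.

(** This is the real part of phi d = i d, with the factor 1 / sqrt 2 cancelled. *)
Lemma phi_e1 : phi e1 = e2.
Proof.
have := congr1 (@complex.Re _) (np_phi_d npf).
by rewrite /np_d /clin /cmuli [LHS]/= [RHS]/= opprK acm_phiZ => /scale_sqrt2VI.
Qed.

Lemma phi_e2 : phi e2 = - e1.
Proof.
by rewrite -phi_e1 (acm_phi2 acm) acm_etaE (metric_e13 onE) scale0r addr0.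
Qed.

Let p := g (nabla e1 e1) e2.
Let q := g (nabla e2 e1) e2.
Let r := g (nabla xi e1) e2.

(** Differentiating the orthonormality relations removes the [e1] component and moves the derivative
    in the [xi] component onto [xi], where [nabla_xi] applies. *)
Lemma nabla_e1 X :
  nabla X e1 = g (nabla X e1) e2 *: e2 - g (nabla X xi) e1 *: xi.
Proof.
rewrite {1}(frame3_expansion frE onE (nabla X _)).
rewrite (metric_nabla_self lc _ _ (metric_e11 onE)) scale0r add0r.
by rewrite (metric_nabla_swap lc _ _ _ (metric_e13 onE)) scaleNr.
Qed.

Lemma nabla_e2 X :
  nabla X e2 = - g (nabla X e1) e2 *: e1 - g (nabla X xi) e2 *: xi.
Proof.
rewrite {1}(frame3_expansion frE onE (nabla X _)).
rewrite (metric_nabla_self lc _ _ (metric_e22 onE)) scale0r addr0.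
rewrite (metric_nabla_swap lc _ _ _ (metric_e21 onE)).
by rewrite (metric_nabla_swap lc _ _ _ (metric_e23 onE)) !scaleNr.
Qed.

Ltac solve_nabla :=
  rewrite ?nabla_e1 ?nabla_e2 !nabla_xi ?phi_e1 ?phi_e2 ?(acm_phi_xi acm);
  rewrite !(metricE, metric_frameE onE);
  apply: vf_ext => f; apply: sfun_ext => x;
  rewrite !(vfieldD, vfieldN, vfieldZ, vfield0, sfunE); ring.

Lemma nabla11 : nabla e1 e1 = p *: e2 + (- be) *: xi.
Proof. rewrite nabla_e1 -/p; solve_nabla. Qed.
Lemma nabla12 : nabla e1 e2 = (- p) *: e1 + al *: xi.
Proof. rewrite nabla_e2 -/p; solve_nabla. Qed.
Lemma nabla13 : nabla e1 xi = be *: e1 + (- al) *: e2.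
Proof. solve_nabla. Qed.
Lemma nabla21 : nabla e2 e1 = q *: e2 + (- al) *: xi.
Proof. rewrite nabla_e1 -/q; solve_nabla. Qed.
Lemma nabla22 : nabla e2 e2 = (- q) *: e1 + (- be) *: xi.
Proof. rewrite nabla_e2 -/q; solve_nabla. Qed.
Lemma nabla23 : nabla e2 xi = al *: e1 + be *: e2.
Proof. solve_nabla. Qed.
Lemma nabla31 : nabla xi e1 = r *: e2.
Proof. rewrite nabla_e1 -/r; solve_nabla. Qed.
Lemma nabla32 : nabla xi e2 = (- r) *: e1.
Proof. rewrite nabla_e2 -/r; solve_nabla. Qed.
Lemma nabla33 : nabla xi xi = 0.
Proof. solve_nabla. Qed.


Let nE := (nabla11, nabla12, nabla13, nabla21, nabla22, nabla23, nabla31,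
  nabla32, nabla33).

(** * Spin coefficients and their derivatives in real terms *)

Lemma cbilinE (U V : Type) (W : zmodType) (B : U -> V -> W) x1 x2 y1 y2 :
  cbilin B (x1 +i* x2) (y1 +i* y2) =
  (B x1 y1 - B x2 y2) +i* (B x1 y2 + B x2 y1).
Proof. by []. Qed.

Lemma vf_sM X f : X (s * f) = s * X f.
Proof. by rewrite vf_leibniz vf_const mul0r add0r. Qed.

Local Notation d := (np_d e1 e2).
Local Notation dbar := (np_dbar e1 e2).

Ltac expand_np :=
  rewrite !cbilinE;
  rewrite !(nablaE lc, vf_const, vf1, vfN, oppr0, scale0r, addr0, add0r) !nE;
  rewrite !(metricE, metric_frameE onE).

Lemma rho_npE : rho_np g nabla d dbar (clift xi) = be +i* al.
Proof.
rewrite /rho_np /np_d /np_dbar /clift -/s.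
expand_np; congr (_ +i* _); apply: sfun_ext => x; rewrite !sfunE.
  (* Displaying [2^-1] lets it be rewritten as the square of (sqrt 2)^-1, matching the two
     normalizing factors coming from [d] and [dbar]. *)
  transitivity (2 * (2^-1 * be x)); last by field.
  by rewrite -sqrt2V_sqr; ring.
transitivity (2 * (2^-1 * al x)); last by field.
by rewrite -sqrt2V_sqr; ring.
Qed.

Lemma beta_npE : beta_np g nabla d dbar = (s * q) +i* (s * p).
Proof.
rewrite /beta_np /np_d /np_dbar -/s.
expand_np; congr (_ +i* _); apply: sfun_ext => x; rewrite !sfunE.
  (* Three frame vectors contribute three factors (sqrt 2)^-1: two pair into [2^-1], one stays. *)
  transitivity (2 * 2^-1 * (Num.sqrt 2)^-1 * q x); last by field.
  by rewrite -sqrt2V_sqr; ring.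
transitivity (2 * 2^-1 * (Num.sqrt 2)^-1 * p x); last by field.
by rewrite -sqrt2V_sqr; ring.
Qed.

Lemma epsilon_npE : epsilon_np g nabla d dbar (clift xi) = 0 +i* r.
Proof.
rewrite /epsilon_np /np_d /np_dbar /clift -/s.
expand_np; congr (_ +i* _); apply: sfun_ext => x; rewrite !sfunE.
  by ring.
transitivity (2 * (2^-1 * r x)); last by field.
by rewrite -sqrt2V_sqr; ring.
Qed.


Lemma trans_sasakian_xi_al : xi al + (al * be + al * be) = 0.
Proof. by apply: (xi_al lc onE); rewrite ?nE. Qed.

Lemma trans_sasakian_einstein (a : R) : einstein g nabla a <-> forall x,
  [/\ (- al * al - be * be - p * p - q * q + (al * r + al * r) - e1 q + e2 p
       - xi be - be * be + al * al) x = a,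
      (- xi be - be * be + al * al) x *+ 2 = a,
      e1 be x + e2 al x = 0 & e1 al x - e2 be x = 0].
Proof. by apply: (einstein_structure lc frE onE); rewrite ?nE. Qed.

Lemma cderiv_rho_xi x :
  cvalue (cderiv (clift xi) (be +i* al)) x = xi be x +i* xi al x.
Proof.
rewrite /cderiv /clift cbilinE /cvalue; congr (_ +i* _).
  by rewrite sfunB vfield0 subr0.
by rewrite sfunD vfield0 addr0.
Qed.

Lemma cderiv_rho_d x : cvalue (cderiv d (be +i* al)) x =
  (Num.sqrt 2)^-1 * (e1 be x + e2 al x)
  +i* ((Num.sqrt 2)^-1 * (e1 al x - e2 be x)).
Proof.
rewrite /cderiv /np_d cbilinE /cvalue; congr (_ +i* _).
  by rewrite !(vfieldN, vfieldZ, sfunE); ring.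
by rewrite !(vfieldN, vfieldZ, sfunE); ring.
Qed.

(** The value is conjugate to that of [dbar] on [bet], so the two add up to the real function e1 q -
    e2 p. *)
Lemma cderiv_beta_d x : cvalue (cderiv d (cconj ((s * q) +i* (s * p)))) x =
  (2^-1 * (e1 q x - e2 p x)) +i* (- (2^-1 * (e1 p x + e2 q x))).
Proof.
rewrite /cderiv /np_d /cconj cbilinE /cvalue -/s -sqrt2V_sqr; congr (_ +i* _).
  by rewrite !(vfieldN, vfieldZ, vfN, vf_sM, sfunE); ring.
by rewrite !(vfieldN, vfieldZ, vfN, vf_sM, sfunE); ring.
Qed.

Lemma cderiv_beta_dbar x : cvalue (cderiv dbar ((s * q) +i* (s * p))) x =
  (2^-1 * (e1 q x - e2 p x)) +i* (2^-1 * (e1 p x + e2 q x)).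
Proof.
rewrite /cderiv /np_dbar cbilinE /cvalue -/s -sqrt2V_sqr; congr (_ +i* _).
  by rewrite !(vfieldN, vfieldZ, vf_sM, sfunE); ring.
by rewrite !(vfieldN, vfieldZ, vf_sM, sfunE); ring.
Qed.

Lemma cvalueE f h x : cvalue (f +i* h) x = f x +i* h x.
Proof. by []. Qed.

(** The term (rho - conj rho) eps equals - 2 al r, and 2 |bet|^2 equals p^2 + q^2. The imaginary
    part reduces to that of - xi(rho) - rho^2, which is zero. *)
Lemma np_ricci_dE x :
  let rho := rho_np g nabla d dbar (clift xi) in
  let bet := beta_np g nabla d dbar in
  let eps := epsilon_np g nabla d dbar (clift xi) in
  - `|cvalue rho x| ^+ 2 - 2 * `|cvalue bet x| ^+ 2
    - (cvalue rho x - (cvalue rho x)^*) * cvalue eps x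
    - cvalue (cderiv (clift xi) rho) x - cvalue rho x ^+ 2
    - cvalue (cderiv d (cconj bet)) x - cvalue (cderiv dbar bet) x =
  ((- al * al - be * be - p * p - q * q + (al * r + al * r) - e1 q + e2 p
       - xi be - be * be + al * al) x)%:C.
Proof.
move=> rho bet eps; rewrite /rho /bet /eps rho_npE beta_npE epsilon_npE.
rewrite cderiv_rho_xi cderiv_beta_d.
rewrite cderiv_beta_dbar !cvalueE !sqr_normc !mulr_natl !mulr2n !expr2.
have xi0 := congr1 (fun f : C => f x) trans_sasakian_xi_al.
rewrite !sfunE in xi0 *.
have ss (u : R) : (Num.sqrt 2)^-1 * u * ((Num.sqrt 2)^-1 * u) = 2^-1 * (u * u).
  by rewrite -sqrt2V_sqr; ring.
apply/eqP; rewrite eq_complex /=; apply/andP; split; apply/eqP.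
  by rewrite !mulrN ?ss; field.
(* In the imaginary part, [trans_sasakian_xi_al] eliminates the derivative of [al]. *)
have -> : xi al x = - (al x * be x + al x * be x) by lra.
by field.
Qed.

Lemma np_ricci_xiE x :
  let rho := rho_np g nabla d dbar (clift xi) in
  - 2 * cvalue (cderiv (clift xi) rho) x - 2 * cvalue rho x ^+ 2 =
  ((- xi be - be * be + al * al) x *+ 2)%:C.
Proof.
move=> rho; rewrite /rho rho_npE cderiv_rho_xi cvalueE mulNr !mulr_natl.
have xi0 := congr1 (fun f : C => f x) trans_sasakian_xi_al.
rewrite !sfunE in xi0 *.
apply/eqP; rewrite eq_complex !mulr2n !expr2 /=; apply/andP; split; apply/eqP.
  by ring.
have -> : xi al x = - (al x * be x + al x * be x) by lra.
by ring.
Qed.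

(** Up to the nonzero factor 1 / sqrt 2, the real and imaginary parts of d(rho) are - S(e1,xi) and
    S(e2,xi). *)
Lemma np_ricci_offE x :
  cvalue (cderiv d (rho_np g nabla d dbar (clift xi))) x = 0 <->
  e1 be x + e2 al x = 0 /\ e1 al x - e2 be x = 0.
Proof.
have s0 : (Num.sqrt 2)^-1 != 0 :> R by rewrite invr_eq0 sqrtr_eq0 -ltNge.
rewrite rho_npE cderiv_rho_d; split=> [[/eqP E1 /eqP E2] | [-> ->]].
  by move: E1 E2; rewrite !mulf_eq0 (negPf s0) => /eqP-> /eqP->.
by rewrite !mulr0.
Qed.

End TransSasakian.

(** * Equivalence of the complex equations with the Einstein condition *)

Theorem proposition4p21 (R : realType) (M : manifold R 3)
    (phi : vector_field M -> vector_field M) (xi : vector_field M)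
    (eta : vector_field M -> smooth_fun M) (g : riemannian_metric M)
    (nabla : vector_field M -> vector_field M -> vector_field M)
    (alpha beta : smooth_fun M) (e1 e2 : vector_field M) (a : R)
    (hacm : almost_contact_metric phi xi eta g)
    (hnabla : levi_civita g nabla)
    (htrans : trans_sasakian phi xi eta g nabla alpha beta)
    (hframe : np_frame phi g e1 e2 xi) :
  let d := np_d e1 e2 in
  let dbar := np_dbar e1 e2 in
  let xiC := clift xi in
  let rho := rho_np g nabla d dbar xiC in
  let bet := beta_np g nabla d dbar in
  let eps := epsilon_np g nabla d dbar xiC in
  let E (p : M) : R[i] :=
    - `|cvalue rho p| ^+ 2 - 2 * `|cvalue bet p| ^+ 2
    - (cvalue rho p - (cvalue rho p)^*) * cvalue eps p
    - cvalue (cderiv xiC rho) p - cvalue rho p ^+ 2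
    - cvalue (cderiv d (cconj bet)) p - cvalue (cderiv dbar bet) p in
  einstein g nabla a <->
  (forall p : M,
     a%:C = E p /\
     E p = - 2 * cvalue (cderiv xiC rho) p - 2 * cvalue rho p ^+ 2)
  /\ (forall p : M, cvalue (cderiv d rho) p = 0).
Proof.
move=> d dbar xiC rho bet eps E.
have realI (u v : R) : u%:C = v%:C -> u = v by case.
rewrite (trans_sasakian_einstein hacm hnabla htrans hframe).
split=> [S | [ES dS] x].
  split=> x; case: (S x) => S11 S33 S13 S23; last first.
    exact/(np_ricci_offE hacm hnabla htrans hframe).
  rewrite /E (np_ricci_dE hacm hnabla htrans hframe).
  by rewrite (np_ricci_xiE hacm hnabla htrans hframe) S11 S33.
(* Both complex expressions are embedded real numbers, so injectivity of the embedding recovers the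
   two diagonal Ricci equations. *)
have [aE] := ES x; rewrite -{}aE (np_ricci_xiE hacm hnabla htrans hframe).
move=> /realI <-.
have [aE _] := ES x; move: aE.
rewrite /E (np_ricci_dE hacm hnabla htrans hframe) => /realI <-.
by have [] := (np_ricci_offE hacm hnabla htrans hframe x).1 (dS x).
Qed.
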